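(* Let $t$ and $\lambda$ be positive integers with $t\ge \lambda+2$. If $D$ is a $(t,\lambda)$-liking digraph, then $D$ is isomorphic to the complete digraph $\overleftrightarrow{K}_{t+\lambda}$ on $t+\lambda$ vertices. That is, $\overleftrightarrow{K}_{t+\lambda}$ is the only $(t,\lambda)$-liking digraph.
   Context: All digraphs are finite and have no loops and no multiple arcs. For positive integers $t,\lambda$, a digraph $D$ is a $(t,\lambda)$-liking digraph if every set of $t$ distinct vertices of $D$ has exactly $\lambda$ common out-neighbors (the definition presumes $D$ has at least $t$ vertices). The complete digraph $\overleftrightarrow{K}_n$ is the digraph on $n$ vertices in which $x\to y$ and $y\to x$ for every pair of distinct vertices $x,y$. *)

(* Defs.v *)
From mathcomp Require Import all_boot.

Set Implicit Arguments.
Unset Strict Implicit.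
Unset Printing Implicit Defensive.

(* Multiple arcs are excluded because the arcs form a relation. *)
Record digraph := Digraph {
  vertex :> finType;
  arc : rel vertex;
  arc_irrefl : irreflexive arc
}.

Definition out_neighbors (D : digraph) (x : D) : {set D} :=
  [set y | arc x y].

Definition common_out_neighbors (D : digraph) (S : {set D}) : {set D} :=
  \bigcap_(x in S) out_neighbors x.

(* The bound t <= #|D| excludes digraphs with fewer than t vertices, for which
   the second condition would hold vacuously. *)
Definition liking_digraph (t lambda : nat) (D : digraph) : Prop :=
  t <= #|D| /\
  forall S : {set D}, #|S| = t -> #|common_out_neighbors S| = lambda.

Definition digraph_iso (D E : digraph) : Prop :=
  exists2 f : D -> E, bijective f & forall x y : D, arc (f x) (f y) = arc x y.

Lemma complete_arc_irrefl (n : nat) : irreflexive (fun x y : 'I_n => x != y).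
Proof. by move=> x; rewrite eqxx. Qed.

Definition complete_digraph (n : nat) : digraph :=
  Digraph (@complete_arc_irrefl n).

(* Main.v *)
(** Fix a set [T] of [t - 2] vertices. The in-neighborhoods of the common
    out-neighbors of [T], restricted to the complement of [T], contain any two
    points of that complement together exactly [lambda] times, and any single
    point more than [lambda] times, since no in-neighborhood contains its own
    vertex. Fisher's inequality then gives at least [#|~: T|] common
    out-neighbors of [T]; as they all avoid [T], every vertex of [T] dominates
    every vertex outside [T]. Since [0 < t - 2], the digraph is complete. *)
From mathcomp Require Import all_boot all_order all_algebra.
(* Imported last because [path.arc] would shadow [Defs.arc]. *)
Require Import Defs.

Set Implicit Arguments.
Unset Strict Implicit.
Unset Printing Implicit Defensive.

Section Fisher.
Import Order.TTheory GRing.Theory Num.Theory.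
Local Open Scope ring_scope.

(** The Gram matrix is positive definite: its quadratic form at [v] is [l] times the square of the
    coordinate sum, plus a positively weighted sum of squares. It is therefore invertible, and a
    right inverse of it yields one of [A]. *)
Lemma row_free_gram (m n : nat) (A : 'M[rat]_(m, n)) (l : rat) (d : 'rV[rat]_m) :
  0 <= l -> (forall i, 0 < d 0 i) ->
  A *m A^T = const_mx l + diag_mx d -> row_free A.
Proof.
move=> l_ge0 d_gt0 gramA; apply/row_freeP.
suff /row_freeP[B AB1] : row_free (A *m A^T).
  by exists (A^T *m B); rewrite mulmxA.
rewrite -kermx_eq0; apply/rowV0P => v /sub_kermxP v0.
have : (v *m (A *m A^T) *m v^T) 0 0 = 0 by rewrite v0 mul0mx mxE.
have -> : (v *m (A *m A^T) *m v^T) 0 0 =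
    l * (\sum_i v 0 i) ^+ 2 + \sum_i d 0 i * v 0 i ^+ 2.
  rewrite gramA mulmxDr mulmxDl mxE; congr (_ + _); rewrite mxE.
    rewrite expr2 mulrA mulr_sumr; apply: eq_bigr => j _; rewrite !mxE.
    congr (_ * _); rewrite mulr_sumr; apply: eq_bigr => i _.
    by rewrite mxE mulrC.
  apply: eq_bigr => j _.
  by rewrite mul_mx_diag !mxE expr2 [v 0 j * d 0 j]mulrC mulrA.
have term_ge0 i : 0 <= d 0 i * v 0 i ^+ 2.
  by apply: mulr_ge0 (sqr_ge0 _); apply: ltW.
have sum_ge0 : 0 <= \sum_i d 0 i * v 0 i ^+ 2.
  by apply: sumr_ge0 => i _; apply: term_ge0.
move/eqP; rewrite paddr_eq0 ?(mulr_ge0 l_ge0 (sqr_ge0 _)) // => /andP[_].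
rewrite psumr_eq0 => [/allP z|i _]; last exact: term_ge0.
apply/rowP => i; rewrite mxE; apply/eqP.
have := z i (mem_index_enum i).
by rewrite /= mulf_eq0 expf_eq0 /= (gt_eqF (d_gt0 i)).
Qed.

(** The incidence matrix of points [P] against blocks [B] has linearly independent rows, because off
    the diagonal its Gram matrix is constantly [l] and on it every entry exceeds [l]. *)
Lemma fisher_inequality (T U : finType) (r : T -> U -> bool) (P : {set T})
    (B : {set U}) (l : nat) :
  {in P &, forall p q, p != q -> #|[set y in B | r p y && r q y]| = l} ->
  {in P, forall p, l < #|[set y in B | r p y]|}%N ->
  (#|P| <= #|B|)%N.
Proof.
move=> pairP pointP.
pose A : 'M[rat]_(#|P|, #|B|) :=
  \matrix_(i, j) (r (enum_val i) (enum_val j))%:R.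
(* The excess over [l] of the number of blocks through each point. *)
pose d : 'rV[rat]_#|P| :=
  \row_i (#|[set y in B | r (enum_val i) y]|%:R - l%:R).
have gramE i k : (A *m A^T) i k =
    #|[set y in B | r (enum_val i) y && r (enum_val k) y]|%:R.
  transitivity
    (\sum_(y in B) ((r (enum_val i) y && r (enum_val k) y) : nat)%:R : rat).
    rewrite mxE [RHS]big_enum_val; apply: eq_bigr => j _.
    by rewrite !mxE -natrM mulnb.
  rewrite -natr_sum -big_mkcondr /= -sum1_card; congr (_%:R).
  by apply: eq_bigl => y; rewrite inE.
(* Full row rank turns [#|P|] into the rank of [A], which the number of columns [#|B|] bounds. *)
have /eqP <- : row_free A.
  apply: (@row_free_gram _ _ A l%:R d); first exact: ler0n.
    by move=> i; rewrite mxE subr_gt0 ltr_nat pointP ?enum_valP.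
  apply/matrixP => i k; rewrite gramE !mxE; case: eqVneq => [->|neq_ik].
    rewrite mulr1n addrC subrK; congr (#|pred_of_set _|%:R).
    by apply/setP => y; rewrite !inE andbb.
  rewrite mulr0n addr0 pairP ?enum_valP //.
  by apply: contraNneq neq_ik => /enum_val_inj ->.
exact: rank_leq_col.
Qed.

End Fisher.

Lemma common_out_neighborsP (D : digraph) (S : {set D}) (y : D) :
  reflect {in S, forall x, arc x y} (y \in common_out_neighbors S).
Proof.
by apply: (iffP bigcapP) => yS x xS; have := yS x xS; rewrite inE.
Qed.

Lemma common_out_neighborsU1 (D : digraph) (S : {set D}) (p : D) :
  common_out_neighbors (p |: S) = [set y in common_out_neighbors S | arc p y].
Proof.
apply/setP => y; rewrite inE; apply/common_out_neighborsP/andP.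
  move=> yS; split; last by rewrite yS ?setU11.
  by apply/common_out_neighborsP => x xS; rewrite yS ?setU1r.
by case=> /common_out_neighborsP yS py x /setU1P[->|/yS].
Qed.

Lemma common_out_neighbors_disjoint (D : digraph) (S : {set D}) :
  common_out_neighbors S \subset ~: S.
Proof.
apply/subsetP => y /common_out_neighborsP yS; rewrite inE.
by apply/negP => /yS; rewrite arc_irrefl.
Qed.

Lemma exists_subset_card (T : finType) (A : {set T}) (k : nat) :
  k <= #|A| -> exists2 B : {set T}, B \subset A & #|B| = k.
Proof.
(* The [k]-subsets of [A] are counted by a binomial coefficient, positive when [k <= #|A|]. *)
rewrite -bin_gt0 -(cards_draws A k) card_gt0 => /set0Pn[B].
by rewrite inE => /andP[BA /eqP cardB]; exists B.
Qed.

Section Liking.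
Variables (t lambda : nat) (D : digraph).
Hypotheses (lambda_gt0 : 0 < lambda) (likingD : liking_digraph t lambda D).

(** Extending [S] by any outside vertex [q] produces a common out-neighbor [y] of [S], itself
    outside [S]. The [lambda] common out-neighbors of [y |: S] are among those of [S] but miss [y],
    as there are no loops. *)
Lemma liking_common_gt (S : {set D}) :
  #|S|.+1 = t -> lambda < #|common_out_neighbors S|.
Proof.
case: likingD => le_tD likD cardS.
have cardU q : q \notin S -> #|common_out_neighbors (q |: S)| = lambda.
  by move=> qS; apply: likD; rewrite cardsU1 qS.
have sub q : common_out_neighbors (q |: S) \subset common_out_neighbors S.
  by rewrite common_out_neighborsU1; apply/subsetP => y; rewrite inE => /andP[].
have [q qS] : exists q, q \in ~: S.
  by apply/set0Pn; rewrite -card_gt0 -(ltn_add2l #|S|) addn0 cardsC cardS.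
have [y yq] : exists y, y \in common_out_neighbors (q |: S).
  by apply/set0Pn; rewrite -card_gt0 cardU // -in_setC.
have yS := subsetP (sub q) y yq.
have ynS : y \notin S.
  by rewrite -in_setC (subsetP (common_out_neighbors_disjoint S)).
rewrite -(cardU y ynS); apply: proper_card; rewrite properE sub /=.
apply/subsetPn; exists y => //.
by rewrite common_out_neighborsU1 inE arc_irrefl andbF.
Qed.

Lemma liking_common_setC (T : {set D}) :
  #|T|.+2 = t -> common_out_neighbors T = ~: T.
Proof.
move=> cardT; apply/eqP; rewrite eqEcard common_out_neighbors_disjoint /=.
apply: (@fisher_inequality _ _ (@arc D) _ _ lambda) => [p q|p].
  rewrite !inE => pT qT neq_pq.
  rewrite -(likingD.2 (q |: (p |: T))).
    rewrite !common_out_neighborsU1; congr #|pred_of_set _|.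
    by apply/setP => y; rewrite !inE andbA.
  by rewrite !cardsU1 !inE negb_or eq_sym neq_pq pT qT.
rewrite inE => pT; rewrite -common_out_neighborsU1.
by apply: liking_common_gt; rewrite cardsU1 pT.
Qed.

Lemma liking_complete (x y : D) : 2 < t -> arc x y = (x != y).
Proof.
move=> t_gt2; case: eqVneq => [->|neq_xy]; first exact: arc_irrefl.
(* Choose [t - 3] vertices avoiding [x] and [y]; adding [x] gives a set of size [t - 2] that still
   misses [y]. *)
have [|T0 /subsetP sT0 cardT0] := @exists_subset_card _ (~: [set x; y]) t.-2.-1.
  rewrite -(leq_add2l #|[set x; y]|) cardsC cards2 neq_xy.
  by apply: leq_trans likingD.1; case: t t_gt2 => [|[|[|]]].
have [xT0 yT0] : x \notin T0 /\ y \notin T0.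
  by split; apply/negP => /sT0; rewrite !inE eqxx ?orbT.
have : y \in common_out_neighbors (x |: T0).
  rewrite liking_common_setC ?inE 1?eq_sym ?negb_or ?neq_xy //.
    by rewrite cardsU1 xT0 cardT0; case: t t_gt2 => [|[|[|]]].
by move/common_out_neighborsP; apply; rewrite setU11.
Qed.

End Liking.

Lemma complete_common_out_neighbors (D : digraph) (S : {set D}) :
  (forall x y : D, arc x y = (x != y)) -> common_out_neighbors S = ~: S.
Proof.
move=> arcE; apply/setP => y; rewrite inE.
apply/common_out_neighborsP/idP => [yS|yS x xS].
  by apply/negP => /yS; rewrite arc_irrefl.
by rewrite arcE; apply: contraNneq yS => <-.
Qed.

Lemma digraph_iso_completeP (D : digraph) (n : nat) :
  digraph_iso D (complete_digraph n) <->
  #|D| = n /\ forall x y : D, arc x y = (x != y).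
Proof.
split=> [[f bij_f arc_f]|[<- arcE]].
  split; first by rewrite (bij_eq_card bij_f) card_ord.
  by move=> x y; rewrite -arc_f /= (inj_eq (bij_inj bij_f)).
exists enum_rank; first exact: enum_rank_bij.
by move=> x y; rewrite arcE /= (inj_eq enum_rank_inj).
Qed.

Theorem theorem1p1 (t lambda : nat) (ht : 0 < t) (hlambda : 0 < lambda)
    (htl : lambda + 2 <= t) (D : digraph) :
  liking_digraph t lambda D <-> digraph_iso D (complete_digraph (t + lambda)).
Proof.
apply: iff_trans (iff_sym (digraph_iso_completeP D (t + lambda))).
split=> [likD|[cardD arcE]].
  have t_gt2 : 2 < t by apply: leq_trans htl; rewrite addn2 !ltnS.
  have arcE x y := liking_complete hlambda likD x y t_gt2.
  split=> //; case: likD => le_tD likD.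
  (* In a complete digraph the complement of a [t]-set is its set of common out-neighbors, so it has
     [lambda] elements. *)
  have [|S _ cardS] := @exists_subset_card _ [set: D] t; first by rewrite cardsT.
  by rewrite -(cardsC S) -(likD S cardS) complete_common_out_neighbors // cardS.
split=> [|S cardS]; first by rewrite cardD leq_addr.
rewrite complete_common_out_neighbors //.
by apply/eqP; rewrite -(eqn_add2l #|S|) cardsC cardD cardS.
Qed.
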